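(* Let $\{ \lambda_n \} \subset (0, +\infty)$ be an increasing unbounded sequence, and let a sequence $\{ (x_n, p_n) \} \subset A \times P$ satisfy $$F_{\lambda_n}(x_n, p_n) \le \inf_{(x, p) \in A \times P} F_{\lambda_n}(x, p) + \varepsilon \quad \forall n \in \mathbb{N}$$ for some $\varepsilon > 0$. Suppose also that $F_{\lambda}$ is bounded below on $A \times P$ for some $\lambda \ge 0$. Then: (1) $\varphi(x_n, p_n) \to 0$ as $n \to \infty$; (2) if there exists a non-decreasing function $\omega \colon \mathbb{R}_+ \to \mathbb{R}_+$ such that $\omega(t) = 0$ iff $t = 0$ and $\varphi(x, p) \ge \omega(d(p, p_0))$ for all $(x,p) \in A \times P$, then $p_n \to p_0$ as $n \to \infty$; (3) if $A$ is closed and $\varphi$ is l.s.c. on $A \times P$, then every cluster point of the sequence $\{ (x_n, p_n) \}$ (if one exists) belongs to $\Omega \times \{ p_0 \}$; (4) $\lim_{\eta \to +0} \beta(\eta) \le \liminf_{n \to \infty} f(x_n) \le \limsup_{n \to \infty} f(x_n) \le \lim_{\eta \to +0} \beta(\eta) + \varepsilon$; (5) if the zero duality gap property holds true for $F_\lambda$, then $f^* \le \liminf_{n \to \infty} f(x_n) \le \limsup_{n \to \infty} f(x_n) \le f^* + \varepsilon$.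
   Context: Setting. $X$ and $P$ are metric spaces, $M, A \subset X$ are nonempty, $f \colon X \to \mathbb{R} \cup \{+\infty\}$. The problem $(\mathcal{P})$ is: minimize $f(x)$ subject to $x \in M$, $x \in A$. $\Omega = M \cap A$; it is assumed that $f$ attains a global minimum on $\Omega$, with finite value $f^*$. $p_0 \in P$ is fixed, and $\varphi \colon X \times P \to [0, +\infty]$ satisfies $\varphi(x, p) = 0$ iff $p = p_0$ and $x \in M$. The parametric penalty function is $F_{\lambda}(x, p) = f(x) + \lambda \varphi(x, p)$, $\lambda \ge 0$. $\mathbb{R}_+ = [0,+\infty)$. The perturbation function is $\beta(\eta) = \inf\{ f(x) \mid x \in A,\ \inf_{p \in P} \varphi(x, p) \le \eta \}$, $\eta > 0$ (non-increasing in $\eta$). The zero duality gap property for $F_\lambda$ means $\sup_{\lambda \ge 0} \inf_{(x, p) \in A \times P} F_{\lambda}(x, p) = \inf_{x \in \Omega} f(x)$. ''L.s.c. on a set'' means lower semicontinuous at every point of that set. *)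

(* Defs.v *)
From mathcomp Require Import all_boot all_order all_algebra.
From mathcomp Require Import all_classical all_reals all_analysis.

Set Implicit Arguments.
Unset Strict Implicit.
Unset Printing Implicit Defensive.

Import Order.TTheory GRing.Theory Num.Theory.
Import numFieldNormedType.Exports.

Local Open Scope classical_set_scope.
Local Open Scope ring_scope.
Local Open Scope ereal_scope.

(* Pointwise version of [lower_semicontinuous], with neighbourhoods taken in
   the whole space [T]. *)
Definition lsc_at (T : topologicalType) (R : realType) (g : T -> \bar R)
    (x : T) : Prop :=
  forall a : R, a%:E < g x ->
    exists2 V, nbhs x V & forall y, V y -> a%:E < g y.

Definition lsc_on (T : topologicalType) (R : realType) (D : set T)
    (g : T -> \bar R) : Prop :=
  forall x, D x -> lsc_at g x.

Definition attains_min (T : Type) (R : realType) (D : set T)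
    (g : T -> \bar R) (m : R) : Prop :=
  (exists2 x, D x & g x = m%:E) /\ (forall x, D x -> m%:E <= g x).

Section ParametricPenalty.
Variables (R : realType) (X P : Type).
Variables (f : X -> \bar R) (phi : X -> P -> \bar R) (A : set X).

(* When [phi x p = +oo] and [lambda = 0], [0 * +oo = 0], hence the value is
   [f x]. *)
Definition penalty_fun (lambda : R) (x : X) (p : P) : \bar R :=
  f x + lambda%:E * phi x p.

Definition inf_penalty (lambda : R) : \bar R :=
  ereal_inf [set penalty_fun lambda xp.1 xp.2 | xp in A `*` [set: P]].

Definition penalty_bounded_below (lambda : R) : Prop :=
  exists c : R, forall x p, A x -> c%:E <= penalty_fun lambda x p.

Definition perturbation_fun (eta : R) : \bar R :=
  ereal_inf [set f x | x in
    [set x | A x /\ ereal_inf [set phi x p | p in [set: P]] <= eta%:E]].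

Definition zero_duality_gap (M : set X) : Prop :=
  ereal_sup [set inf_penalty lambda | lambda in [set l : R | (0 <= l)%R]] =
  ereal_inf [set f x | x in M `&` A].

End ParametricPenalty.

(* Main.v *)
Require Import Defs.
From mathcomp Require Import all_boot all_order all_algebra.
From mathcomp Require Import all_classical all_reals all_analysis.
From mathcomp Require Import ring lra.

Import Order.TTheory GRing.Theory Num.Theory.
Import numFieldNormedType.Exports.

Local Open Scope classical_set_scope.
Local Open Scope ring_scope.
Local Open Scope ereal_scope.

(* Write F_l for the penalty function and beta for the perturbation function.
   Comparing the lower bound of F_l with F_(lam n) (x_n, p_n) <= fstar + eps
   gives phi (x_n, p_n) = O(1 / (lam n - l)), hence (1), and (2), (3) follow.
   Consequently beta eta <= f (x_n) for n large, and conversely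
   inf F_l <= beta eta + 2 l eta for every eta > 0, so that
   inf F_l <= lim beta; this gives (4).
   Zero duality gap says fstar = sup_l inf F_l <= lim beta, whence (5). *)

Lemma limn_einf_ge_near (R : realType) (u : (\bar R)^nat) (b : \bar R) :
  (\forall n \near \oo, b <= u n) -> b <= limn_einf u.
Proof.
move=> [N _ bu]; rewrite limn_einf_lim; apply: lime_ge; first exact: is_cvg_einfs.
exists N => // n Nn; apply: le_ereal_inf_tmp => _ [m /= nm <-].
by apply: bu => /=; apply: leq_trans nm.
Qed.

Lemma limn_esup_le (R : realType) (u : (\bar R)^nat) (b : \bar R) :
  (forall n, u n <= b) -> limn_esup u <= b.
Proof.
move=> ub; rewrite limn_esup_lim; apply: lime_le; first exact: is_cvg_esups.
by apply: nearW => n; apply: ge_ereal_sup => _ [m _ <-].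
Qed.

(** Subtracting the two bounds gives [(l - k) * b <= C - c]. Infinite values of [a] or [b] are
    excluded because, as [l > 0], they would make [a + l%:E * b] infinite, against the real bound
    [C]. *)
Lemma penalty_gap_le (R : realType) (a b : \bar R) (c C k l : R) :
  a != -oo -> 0 <= b -> (0 <= k)%R -> (k < l)%R ->
  c%:E <= a + k%:E * b -> a + l%:E * b <= C%:E ->
  b <= ((C - c) / (l - k))%:E.
Proof.
case: a => [a| |] // _ b0 k0 kl; last first.
  by move=> _; rewrite addye// -ltNye (@lt_le_trans _ _ 0)// mule_ge0// lee_fin
    (le_trans k0) ?ltW.
case: b b0 => [b| |] // b0; last first.
  by move=> _; rewrite gt0_muley ?lte_fin ?(le_lt_trans k0).
rewrite -!EFinM -!EFinD !lee_fin => ca aC.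
by rewrite ler_pdivlMr ?subr_gt0//; lra.
Qed.

Section ParametricPenaltyTheory.
Variables (R : realType) (X P : Type).
Variables (f : X -> \bar R) (phi : X -> P -> \bar R) (A : set X).
Hypothesis phi_ge0 : forall x p, 0 <= phi x p.

Lemma inf_penalty_le (l : R) (x : X) (p : P) :
  A x -> inf_penalty f phi A l <= penalty_fun f phi l x p.
Proof. by move=> Ax; apply: ereal_inf_lbound; exists (x, p). Qed.

Lemma le_penalty_fun (l : R) (x : X) (p : P) :
  (0 <= l)%R -> f x <= penalty_fun f phi l x p.
Proof. by move=> l0; rewrite leeDl// mule_ge0. Qed.

Lemma perturbation_fun_noninc (s t : R) :
  (s <= t)%R -> perturbation_fun f phi A t <= perturbation_fun f phi A s.
Proof.
move=> st; apply: ereal_inf_le_tmp => _ [x [Ax xs] <-]; exists x => //.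
by split=> //; rewrite (le_trans xs) ?lee_fin.
Qed.

Lemma perturbation_fun_le (eta : R) (x : X) (p : P) :
  A x -> phi x p <= eta%:E -> perturbation_fun f phi A eta <= f x.
Proof.
move=> Ax pe; apply: ereal_inf_lbound; exists x => //; split => //.
by apply: ge_ereal_inf; exists (phi x p) => //; exists p.
Qed.

Lemma inf_penalty_le_perturbation (l eta : R) : (0 <= l)%R -> (0 < eta)%R ->
  inf_penalty f phi A l <= perturbation_fun f phi A eta + (l * (2 * eta))%:E.
Proof.
move=> l0 eta0; rewrite -leeBlDr//; apply: le_ereal_inf_tmp => _ [x [Ax xe] <-].
(* The infimum over [p] need not be attained; relaxing [eta] to [2 * eta] makes the inequality
   strict and so yields an actual [p]. *)
have /ereal_inf_lt[_ [p _ <-] pe] :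
    ereal_inf [set phi x p | p in [set: P]] < (2 * eta)%:E.
  by rewrite (le_lt_trans xe)// lte_fin; lra.
rewrite leeBlDr// (le_trans (inf_penalty_le l _ p Ax))// leeD2l//.
by rewrite EFinM lee_wpmul2l// ltW.
Qed.

(** By monotonicity the right limit at 0 always exists in the extended reals, and equals the
    supremum over positive [eta]. *)
Lemma perturbation_fun_cvg :
  perturbation_fun f phi A eta @[eta --> 0%R^'+] -->
  ereal_sup [set perturbation_fun f phi A eta | eta in `]0%R, +oo[].
Proof.
by apply: nonincreasing_at_right_cvge => // s t _ _; exact: perturbation_fun_noninc.
Qed.

Lemma perturbation_fun_le_lim (eta : R) : (0 < eta)%R ->
  perturbation_fun f phi A eta <=
  lim (perturbation_fun f phi A eta @[eta --> 0%R^'+]).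
Proof.
move=> eta0; rewrite (cvg_lim _ perturbation_fun_cvg)//.
by apply: ereal_sup_ubound; exists eta => //=; rewrite in_itv/= eta0.
Qed.

Lemma inf_penalty_le_lim_perturbation (l : R) : (0 <= l)%R ->
  inf_penalty f phi A l <= lim (perturbation_fun f phi A eta @[eta --> 0%R^'+]).
Proof.
move=> l0; apply/lee_addgt0Pr => e e0.
(* With this [eta] the error [l * (2 * eta)] is [e * (l / (l + 1)) <= e]; the [+ 1] covers
   [l = 0]. *)
have eta0 : (0 < e / (2 * (l + 1)))%R by rewrite divr_gt0//; lra.
apply: (le_trans (inf_penalty_le_perturbation _ _ l0 eta0)).
apply: leeD; first exact: perturbation_fun_le_lim.
rewrite lee_fin (_ : (l * _)%R = (e * (l / (l + 1)))%R); last by field; lra.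
by rewrite ler_piMr ?(ltW e0)// ler_pdivrMr; lra.
Qed.

End ParametricPenaltyTheory.

Theorem theorem3p19 (R : realType) (X P : metricType R) (M A : set X)
    (f : X -> \bar R) (fstar : R) (p0 : P) (phi : X -> P -> \bar R)
    (lam : nat -> R) (x_ : nat -> X) (p_ : nat -> P) (eps : R)
    (M_neq0 : M !=set0) (A_neq0 : A !=set0)
    (f_proper : forall x, f x != -oo)
    (f_min : attains_min (M `&` A) f fstar)
    (phi_ge0 : forall x p, 0 <= phi x p)
    (phi_eq0 : forall x p, phi x p = 0 <-> p = p0 /\ M x)
    (lam_gt0 : forall n, (0 < lam n)%R)
    (lam_incr : increasing_seq lam)
    (lam_unbounded : ~ has_ubound (range lam))
    (xA : forall n, A (x_ n))
    (eps_gt0 : (0 < eps)%R)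
    (eps_min : forall n, penalty_fun f phi (lam n) (x_ n) (p_ n)
                         <= inf_penalty f phi A (lam n) + eps%:E)
    (bnd : exists2 l : R, (0 <= l)%R & penalty_bounded_below f phi A l) :
  [/\ (* (1) *)
      phi (x_ n) (p_ n) @[n --> \oo] --> 0,
      (* (2) *)
      (exists omega : R -> R,
         [/\ forall t, (0 <= t)%R -> (0 <= omega t)%R,
             forall s t, (0 <= s)%R -> (s <= t)%R -> (omega s <= omega t)%R,
             forall t, (0 <= t)%R -> (omega t = 0%R <-> t = 0%R) &
             forall x p, A x -> (omega (mdist p p0))%:E <= phi x p]) ->
      p_ n @[n --> \oo] --> p0,
      (* (3) *)
      closed A ->
      lsc_on (A `*` [set: P]) (fun xp : X * P => phi xp.1 xp.2) ->
      cluster ((x_ n, p_ n) @[n --> \oo]) `<=` (M `&` A) `*` [set p0],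
      (* (4) *)
      [/\ cvg (perturbation_fun f phi A eta @[eta --> 0%R^'+]),
          lim (perturbation_fun f phi A eta @[eta --> 0%R^'+])
            <= limn_einf (fun n => f (x_ n)),
          limn_einf (fun n => f (x_ n)) <= limn_esup (fun n => f (x_ n)) &
          limn_esup (fun n => f (x_ n))
            <= lim (perturbation_fun f phi A eta @[eta --> 0%R^'+]) + eps%:E] &
      (* (5) *)
      zero_duality_gap f phi A M ->
      [/\ fstar%:E <= limn_einf (fun n => f (x_ n)),
          limn_einf (fun n => f (x_ n)) <= limn_esup (fun n => f (x_ n)) &
          limn_esup (fun n => f (x_ n)) <= fstar%:E + eps%:E] ].
Proof.
have [[xs [Mxs Axs] fxs] f_ge] := f_min.
have phixs : phi xs p0 = 0 by apply/phi_eq0.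
(* The pair [(xs, p0)] carries no penalty, so its penalty function equals [fstar] for every [l]. *)
have inf_le_fstar l : inf_penalty f phi A l <= fstar%:E.
  by rewrite (le_trans (inf_penalty_le _ _ _ _ _ _ l _ p0 Axs))// /penalty_fun phixs mule0 adde0 fxs.
have phi_small e : (0 < e)%R -> \forall n \near \oo, phi (x_ n) (p_ n) < e%:E.
  move=> e0; have [l l0 [c cF]] := bnd.
  (* [D] is the numerator that [penalty_gap_le] produces. Beyond [K], both [lam n > l] and
     [D / (lam n - l) < e] hold. *)
  pose D := (fstar + eps - c)%R; pose K := (l + (`|D| + 1) / e)%R.
  have [N KN] : exists N, (K < lam N)%R.
    apply: contrapT => /forallNP Klam; apply: lam_unbounded; exists K => _ [n _ <-].
    by rewrite leNgt; apply/negP/Klam.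
  exists N => // n /= Nn.
  have Kn : (K < lam n)%R by rewrite (lt_le_trans KN)// lam_incr.
  have De : (`|D| + 1 < (lam n - l) * e)%R.
    by rewrite -ltr_pdivrMr// ltrBrDl.
  have ln : (l < lam n)%R.
    by rewrite -subr_gt0 -(pmulr_lgt0 _ e0) (le_lt_trans _ De)// addr_ge0.
  apply: (le_lt_trans (penalty_gap_le _ _ _ _ _ _ _ (f_proper _) (phi_ge0 _ _) l0 ln (cF _ _ (xA n))
    (le_trans (eps_min n) (leeD2r _ (inf_le_fstar _))))).
  rewrite lte_fin ltr_pdivrMr ?subr_gt0// mulrC (le_lt_trans (ler_norm _))//.
  by rewrite -/D; lra.
have f_le n : f (x_ n) <= inf_penalty f phi A (lam n) + eps%:E.
  exact: le_trans (le_penalty_fun _ _ _ f _ phi_ge0 _ _ _ (ltW (lam_gt0 n))) (eps_min n).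
have le_limf : lim (perturbation_fun f phi A eta @[eta --> 0%R^'+]) <=
    limn_einf (fun n => f (x_ n)).
  apply: lime_le; first exact: cvgP (perturbation_fun_cvg _ _ _ f phi A).
  (* For fixed [eta > 0], eventually [phi (x_ n) (p_ n) < eta], so [x_ n] competes in the infimum
     defining the perturbation function at [eta]. *)
  near=> eta; apply: limn_einf_ge_near.
  have eta0 : (0 < eta)%R by [].
  have [N _ phiN] := phi_small _ eta0.
  by exists N => // n Nn; apply: (perturbation_fun_le _ _ _ _ _ _ _ _ (p_ n)) => //; exact/ltW/phiN.
split.
- apply/fine_cvgP; split.
    have [N _ phiN] := phi_small _ (@ltr01 R); exists N => // n /phiN phin.
    by rewrite ge0_fin_numE// (lt_trans phin) ?ltry.
  apply/cvgrPdist_lt => e e0; have [N _ phiN] := phi_small _ e0.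
  exists N => // n /phiN phin; rewrite /= sub0r normrN ger0_norm ?fine_ge0//.
  by rewrite -lte_fin fineK// ge0_fin_numE// (lt_trans phin) ?ltry.
- move=> [omega [om_ge0 om_mono om_eq0 om_le]].
  apply/metricType_numDomainType.cvgrPdist_lt => e e0.
  have ome0 : (0 < omega e)%R.
    rewrite lt0r om_ge0 ?ltW// andbT; apply/eqP => /(om_eq0 _ (ltW e0)) e_eq0.
    by move: e0; rewrite e_eq0 ltxx.
  have [N _ phiN] := phi_small _ ome0; exists N => // n /phiN phin /=.
  (* A distance of at least [e] would give [omega e <= omega (mdist (p_ n) p0) <= phi (x_ n) (p_ n)
     < omega e]. *)
  rewrite metric_sym ltNge; apply/negP => /(om_mono _ _ (ltW e0)).
  by rewrite leNgt -lte_fin (le_lt_trans (om_le _ _ (xA n)) phin).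
- move=> cA lsc [x p] cl.
  have Ax : A x.
    (* Every neighbourhood of [x] meets [A]: the cylinder over [V] meets the set of pairs with first
       component in [A], which contains the whole sequence. *)
    apply: cA => V Vx.
    have [] := cl (fst @^-1` A) (fst @^-1` V).
    + by exists 0%N => // n _ /=.
    + by exists (V, setT) => //=; [split => //; exact: filterT|move=> [y q] []].
    + by move=> [y q] /= [Ay Vy]; exists y.
  suff /phi_eq0[-> Mx] : phi x p = 0 by [].
  apply/eqP; rewrite eq_le phi_ge0 andbT leNgt; apply/negP => phi0.
  (* A real level [e] strictly between 0 and [phi x p]: semicontinuity keeps [phi] above [e] near
     [(x, p)], while the tail of the sequence has [phi] below [e]. *)
  have [e e0 ephi] : exists2 e : R, (0 < e)%R & e%:E < phi x p.
    case: (phi x p) phi0 => [r| |] // r0; last by exists 1%R => //; rewrite ltry.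
    by exists (r / 2)%R; move: r0; rewrite ?lte_fin => r0; lra.
  have [V Vxp Vphi] := lsc (x, p) (conj Ax I) e ephi.
  have [||[y q] /= [yq /Vphi /= eyq]] := cl [set yq | phi yq.1 yq.2 < e%:E] V.
  + have [N _ phiN] := phi_small _ e0; exists N => // n /phiN; exact.
  + exact: Vxp.
  + by move: (lt_trans yq eyq); rewrite ltxx.
- split=> //; first exact: cvgP (perturbation_fun_cvg _ _ _ f phi A).
    exact: limn_einf_sup.
  apply: limn_esup_le => n; rewrite (le_trans (f_le n))// leeD2r//.
  exact: inf_penalty_le_lim_perturbation (ltW _).
- move=> gap; split; [|exact: limn_einf_sup|].
    rewrite (le_trans _ le_limf)//.
    apply: (@le_trans _ _ (ereal_inf [set f x | x in M `&` A])).
      by apply: le_ereal_inf_tmp => _ [x Mx <-]; exact: f_ge.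
    rewrite -gap; apply: ge_ereal_sup => _ [l l0 <-].
    exact: inf_penalty_le_lim_perturbation.
  (* Here the upper bound comes from [inf_le_fstar] directly, without passing through the
     perturbation function. *)
  by apply: limn_esup_le => n; rewrite (le_trans (f_le n))// leeD2r.
Unshelve. all: by end_near. Qed.
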